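(* Let $U \subset \mathbb{R}^n$ be an open set, let $f : U \to \mathbb{R}$ be a differentiable function, and let $\{\mathbf{x}_k\}_{k=1}^{\infty} \subset U$ be a sequence of vectors satisfying: (i) there is $\sigma > 0$ such that for all sufficiently large $k$, $f(\mathbf{x}_k) - f(\mathbf{x}_{k+1}) \ge \sigma \|\nabla f(\mathbf{x}_k)\| \, \|\mathbf{x}_{k+1} - \mathbf{x}_k\|$; (ii) for all $k$, $f(\mathbf{x}_k) = f(\mathbf{x}_{k+1})$ implies $\mathbf{x}_k = \mathbf{x}_{k+1}$; (iii) there is $\kappa > 0$ such that for all sufficiently large $k$, $\|\mathbf{x}_{k+1} - \mathbf{x}_k\| \ge \kappa \|\nabla f(\mathbf{x}_k)\|$. Suppose that a cluster point $\mathbf{x}^* \in \mathbb{R}^n$ of the sequence admits an open neighborhood $V \subset \mathbb{R}^n$ and constants $\theta \in (0, 1/2]$ and $c \in \mathbb{R}$ such that for all $k$, $$\mathbf{x}_k \in V \quad\implies\quad \left| f(\mathbf{x}_k) - \lim_{j \to \infty} f(\mathbf{x}_j) \right|^{1-\theta} \le c \|\nabla f(\mathbf{x}_k)\| .$$ Then $\nabla f(\mathbf{x}_k) \to \mathbf{0}$ and, as $k \to \infty$, $$\|\mathbf{x}^* - \mathbf{x}_k\| = \begin{cases} O(q^k) \text{ for some } 0 < q < 1, & \text{if } \theta = \tfrac12, \\ O\left(k^{\frac{-\theta}{1-2\theta}}\right), & \text{if } 0 < \theta < \tfrac12 . \end{cases}$$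
   Context: $\|\cdot\|$ is the Euclidean norm. The cluster point $\mathbf{x}^*$ is not assumed to lie in $U$. The displayed hypothesis includes the requirement that $\lim_{j\to\infty} f(\mathbf{x}_j)$ exists as a finite real number. *)

(* Defs.v *)
From HB Require Import structures.
From mathcomp Require Import all_boot all_order all_algebra.
From mathcomp Require Import all_classical all_reals all_analysis.

Set Implicit Arguments.
Unset Strict Implicit.
Unset Printing Implicit Defensive.

Import Order.TTheory GRing.Theory Num.Theory.
Import numFieldNormedType.Exports.

Local Open Scope classical_set_scope.
Local Open Scope ring_scope.

(* The library norm `|v| on 'rV[R]_n is the sup norm; the Euclidean norm is
   needed wherever a norm is measured. Open sets, limits, cluster points and
   differentiability are the same for the two norms. *)
Definition norm2 (R : realType) (n : nat) (v : 'rV[R]_n) : R :=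
  Num.sqrt (\sum_(i < n) v 0 i ^+ 2).

Definition gradient (R : realType) (n : nat) (f : 'rV[R]_n -> R)
    (a : 'rV[R]_n) : 'rV[R]_n :=
  \row_(i < n) 'D_(delta_mx 0 i) f a.

(* Main.v *)
(* With a_k = f(x_k) - lim f, concavity of s^theta, the descent inequality and
   the Lojasiewicz inequality give |x_(k+1) - x_k| <= D (a_k^theta -
   a_(k+1)^theta) as long as x_k is in V. This telescopes, so the sequence is
   trapped near x* and |x* - x_k| <= D a_k^theta. The rates come from
   M a_k^(2 - 2 theta) <= a_k - a_(k+1): for theta = 1/2 this is geometric
   decay, and otherwise, by convexity of s^(-al) with al = 1 - 2 theta,
   a_k^(-al) grows at least linearly. Constants in O absorb the passage between
   the Euclidean norm and the sup norm. *)

Require Import Defs.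
From HB Require Import structures.
From mathcomp Require Import all_boot all_order all_algebra.
From mathcomp Require Import all_classical all_reals all_analysis.
From mathcomp Require Import ring lra.

Set Implicit Arguments.
Unset Strict Implicit.
Unset Printing Implicit Defensive.

Import Order.TTheory GRing.Theory Num.Theory.
Import numFieldNormedType.Exports.

Local Open Scope classical_set_scope.
Local Open Scope ring_scope.

(** * Comparison of the Euclidean norm with the sup norm *)

Lemma norm_le_norm2 (R : realType) (n : nat) (v : 'rV[R]_n) : `|v| <= norm2 v.
Proof.
have n2_ge0 : 0 <= norm2 v by exact: sqrtr_ge0.
rewrite [`|v|]mx_normrE; apply/bigmax_leP; split=> // -[i j] _ /=.
rewrite ord1 -sqrtr_sqr ler_sqrt ?sumr_ge0// => [|k _]; last exact: sqr_ge0.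
by rewrite (bigD1 j)//= lerDl sumr_ge0// => k _; exact: sqr_ge0.
Qed.

Lemma norm2_le_norm (R : realType) (n : nat) (v : 'rV[R]_n) :
  norm2 v <= n%:R * `|v|.
Proof.
have vi i : `|v 0 i| <= `|v|.
  by rewrite [`|v|]mx_normrE; apply: (le_bigmax _ _ (0, i)).
rewrite -[leRHS]ger0_norm ?mulr_ge0// -sqrtr_sqr ler_sqrt ?sqr_ge0//.
apply: (@le_trans _ _ (\sum_(i < n) `|v| ^+ 2)).
  apply: ler_sum => i _; rewrite -real_normK ?num_real//.
  by rewrite lerXn2r ?nnegrE.
rewrite sumr_const card_ord -[leLHS]mulr_natl exprMn ler_wpM2r ?sqr_ge0//.
by rewrite -natrX ler_nat; case: n {v vi} => // n; rewrite -mulnn leq_pmulr.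
Qed.

(** * Tangent-line inequalities for real powers *)

Lemma powR_tangent_concave (R : realType) (t x y : R) :
  0 < t -> t < 1 -> 0 < x -> 0 <= y ->
  t * x `^ (t - 1) * (x - y) <= x `^ t - y `^ t.
Proof.
move=> t0 t1 x0 y0.
have xt0 : 0 < x `^ t by exact: powR_gt0.
have yx0 : 0 <= y / x by rewrite divr_ge0// ltW.
have step : (y / x) `^ t <= t * (y / x) + (1 - t).
  have := @conjugate_powR R ((y / x) `^ t) 1 t^-1 (1 - t)^-1.
  rewrite !invrK powR1 -powRrM mulfV ?gt_eqF// powRr1// mulr1 mul1r.
  rewrite [_ * t]mulrC; apply; rewrite ?powR_ge0 ?ler01 ?invr_gt0 ?subr_gt0//.
  by rewrite subrKC.
have -> : y `^ t = x `^ t * (y / x) `^ t.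
  by rewrite -powRM ?(ltW x0)// mulrCA mulfV ?mulr1// gt_eqF.
rewrite powRB ?(gt_eqF x0) ?implybT// powRr1 ?(ltW x0)//.
have -> : t * (x `^ t / x) * (x - y) = x `^ t * (t - t * (y / x)).
  by field; rewrite gt_eqF.
rewrite -[X in _ <= X - _]mulr1 -mulrBr ler_wpM2l ?(ltW xt0)//; lra.
Qed.

(** With z = y/x, the bound 1 + u <= exp u is used twice: at u = - a ln z, and at u = z - 1 to get
    ln z <= z - 1. *)
Lemma powRN_tangent_convex (R : realType) (a x y : R) :
  0 < a -> 0 < x -> 0 < y ->
  a * x `^ (- a - 1) * (x - y) <= y `^ (- a) - x `^ (- a).
Proof.
move=> a0 x0 y0.
have xa0 : 0 < x `^ (- a) by exact: powR_gt0.
have yx0 : 0 < y / x by rewrite divr_gt0.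
have step : 1 - a * (y / x - 1) <= (y / x) `^ (- a).
  rewrite /powR gt_eqF//; apply: le_trans (expR_ge1Dx _).
  rewrite lerD2l mulNr lerN2 ler_wpM2l ?(ltW a0)//.
  rewrite -ler_expR lnK ?posrE//.
  by apply: le_trans (expR_ge1Dx _); rewrite subrKC.
have -> : y `^ (- a) = x `^ (- a) * (y / x) `^ (- a).
  by rewrite -powRM ?(ltW x0) ?(ltW yx0)// mulrCA mulfV ?mulr1// gt_eqF.
rewrite powRB ?(gt_eqF x0) ?implybT// powRr1 ?(ltW x0)//.
have -> : a * (x `^ (- a) / x) * (x - y) = x `^ (- a) * (a - a * (y / x)).
  by field; rewrite gt_eqF.
rewrite -[X in _ <= _ - X]mulr1 -mulrBr ler_wpM2l ?(ltW xa0)//; lra.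
Qed.

(** * Trapping of a sequence near its cluster point *)

(* Once u enters the half ball at a time when e is below r/2, the remaining
   length of its path is at most e and it can never leave the ball. *)
Lemma cluster_trapping (R : realType) (V : normedModType R) (u : nat -> V)
    (l : V) (e : nat -> R) (r : R) (K : nat) :
  0 < r -> cluster (u @ \oo) l -> e @ \oo --> (0 : R) ->
  (forall k, 0 <= e k) ->
  (forall k, (K <= k)%N -> `|l - u k| < r -> `|u k.+1 - u k| <= e k - e k.+1) ->
  \forall k \near \oo, `|l - u k| <= e k.
Proof.
move=> r0 cl e0 ege0 step.
have r20 : 0 < r / 2 by rewrite divr_gt0.
have [N _ HN] : \forall k \near \oo, e k < r / 2.
  near=> k; apply: le_lt_trans (ler_norm _) _; near: k.
  by move/cvgr0Pnorm_lt: e0; apply.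
have visit (s : R) m : 0 < s -> exists2 k, (m <= k)%N & `|l - u k| < s.
  move=> s0.
  have tail : (u @ \oo) (u @` [set k | (m <= k)%N]).
    by exists m => // k mk; exists k.
  have ls : nbhs l (ball l s) by exact: nbhsx_ballx.
  have [_ [[k mk <-]]] := cl _ _ tail ls.
  by rewrite -ball_normE /ball_ /=; exists k.
have [k0 k0K k0r] := visit (r / 2) (maxn K N) r20.
move: k0K; rewrite geq_max => /andP[k0K k0N].
have e0r : e k0 < r / 2 by exact: HN.
(* The guard [|l - u m| + e m < r] keeps the whole path from [u m] inside the ball, so [step]
   applies at each index and telescopes. *)
have path m i : (k0 <= m)%N -> `|l - u m| + e m < r ->
    `|u (m + i)%N - u m| <= e m - e (m + i)%N.
  move=> k0m mr; elim: i => [|i IH]; first by rewrite addn0 !subrr normr0.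
  have -> : u (m + i.+1)%N - u m =
      (u (m + i).+1 - u (m + i)%N) + (u (m + i)%N - u m).
    by rewrite addnS subrKA.
  have near_l : `|l - u (m + i)%N| < r.
    have := ler_distD (u m) l (u (m + i)%N).
    rewrite [`|u m - _|]distrC; have := ege0 (m + i)%N; lra.
  have := step (m + i)%N (leq_trans k0K (leq_trans k0m (leq_addr _ _))) near_l.
  have := ler_normD (u (m + i).+1 - u (m + i)%N) (u (m + i)%N - u m).
  rewrite addnS; lra.
exists k0 => // k /= k0k.
have shift j : (k0 <= j)%N -> `|u j - u k0| <= e k0 - e j.
  by move=> k0j; rewrite -(subnKC k0j); apply: path => //; lra.
(* The guard passes from [k0] to [k]: the path from [k0] costs [e k0 - e k], so [e k] cancels and
   r/2 + r/2 remains. *)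
have kr : `|l - u k| + e k < r.
  have := ler_distD (u k0) l (u k).
  rewrite [`|u k0 - _|]distrC; have := shift _ k0k; lra.
(* A later visit [j] within [s] of [l] gives the bound [e k + s], for every [s > 0]. *)
apply/ler_addgt0Pr => s s0.
have [j kj js] := visit s k s0.
have := ler_distD (u j) l (u k).
have := path k (j - k)%N k0k kr; rewrite subnKC//; have := ege0 j; lra.
Unshelve. all: by end_near.
Qed.

(** * Decay rates of scalar recursions *)

Lemma geometric_decay (R : realType) (q : R) (a : nat -> R) (K : nat) :
  0 < q -> (forall k, (K <= k)%N -> a k.+1 <= q * a k) ->
  exists2 A : R, 0 < A & forall k, (K <= k)%N -> a k <= A * q ^+ k.
Proof.
move=> q0 aq; have qK k : 0 < q ^+ k by rewrite exprn_gt0.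
have aK0 : 0 < `|a K| + 1 by rewrite ltr_wpDl.
exists ((`|a K| + 1) / q ^+ K) => [|k]; first by rewrite divr_gt0.
move=> /subnKC <-; elim: (k - K)%N => [|i IH].
  rewrite addn0 divfK ?gt_eqF//; have := ler_norm (a K); lra.
rewrite addnS exprS mulrCA.
by apply: le_trans (aq _ (leq_addr _ _)) _; rewrite ler_pM2l.
Qed.

Lemma sublinear_decay (R : realType) (al M : R) (a : nat -> R) (K : nat) :
  0 < al -> 0 < M -> (forall k, (K <= k)%N -> 0 <= a k) ->
  (forall k, (K <= k)%N -> M * a k `^ (1 + al) <= a k - a k.+1) ->
  forall i, 0 < a (K + i)%N -> al * M * i%:R <= a (K + i)%N `^ (- al).
Proof.
move=> al0 M0 a0 aM; elim=> [|i IH] ai; first by rewrite mulr0 powR_ge0.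
have Ki : (K <= K + i)%N by exact: leq_addr.
have aiM := aM _ Ki; rewrite addnS in ai *.
(* The sequence decreases, so positivity passes back to the previous index, as the induction
   hypothesis requires. *)
have ai0 : 0 < a (K + i)%N.
  apply: lt_le_trans ai _; rewrite -subr_ge0; apply: le_trans aiM.
  by rewrite mulr_ge0 ?powR_ge0// ltW.
have := powRN_tangent_convex al0 ai0 ai.
have : al * M <= al * a (K + i)%N `^ (- al - 1) * (a (K + i)%N - a (K + i).+1).
  rewrite -mulrA ler_pM2l//.
  apply: le_trans (ler_wpM2l (powR_ge0 _ _) aiM).
  rewrite mulrCA -powRD ?(gt_eqF ai0) ?implybT// (_ : - al - 1 + (1 + al) = 0).
    by rewrite powRr0 mulr1.
  by ring.
have := IH ai0; rewrite -natr1; lra.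
Qed.

Lemma sublinear_rate (R : realType) (al M t : R) (a : nat -> R) (K : nat) :
  0 < al -> 0 < M -> 0 < t -> (forall k, (K <= k)%N -> 0 <= a k) ->
  (forall k, (K <= k)%N -> M * a k `^ (1 + al) <= a k - a k.+1) ->
  exists2 B : R, 0 < B &
    \forall k \near \oo, a k `^ t <= B * k%:R `^ (- t / al).
Proof.
move=> al0 M0 t0 a0 aM.
have h0 : 0 < al * M / 2 by rewrite divr_gt0// mulr_gt0.
exists ((al * M / 2) `^ (- t / al)); first exact: powR_gt0.
exists (K + K).+1 => // k /= Kk.
have Kk' : (K <= k)%N by apply: leq_trans (leq_addr K K) (ltnW Kk).
have k0 : 0 < k%:R :> R by rewrite ltr0n (leq_trans _ Kk).
have := a0 _ Kk'; rewrite le_eqVlt => /predU1P[<-|ak].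
  by rewrite powR0 ?gt_eqF// mulr_ge0 ?powR_ge0.
rewrite -powRM ?(ltW h0) ?(ltW k0)//.
(* For k > 2K one has k - K >= k/2, whence the factor 1/2 in the constant. *)
have half : al * M / 2 * k%:R <= a k `^ (- al).
  have := sublinear_decay al0 M0 a0 aM (i := k - K).
  rewrite subnKC// => /(_ ak).
  apply: le_trans; rewrite -mulrA ler_wpM2l ?mulr_ge0 ?(ltW al0) ?(ltW M0)//.
  have : (K + K).+1%:R <= k%:R :> R by rewrite ler_nat.
  rewrite natrB// -natr1 natrD; lra.
have -> : a k `^ t = (a k `^ (- al)) `^ (- t / al).
  by rewrite -powRrM; congr (_ `^ _); field; rewrite gt_eqF.
rewrite mulNr ![_ `^ (- (t / al))]powRN lef_pV2 ?posrE ?powR_gt0 ?mulr_gt0//.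
apply: ge0_ler_powR => //; rewrite ?nnegrE ?powR_ge0//.
  by rewrite divr_ge0 ?ltW.
by rewrite mulr_ge0 ?ltW.
Qed.

Lemma cvg_powR0 (R : realType) (t : R) (a : nat -> R) :
  0 < t -> (forall k, 0 <= a k) -> a @ \oo --> (0 : R) ->
  a k `^ t @[k --> \oo] --> (0 : R).
Proof.
move=> t0 a0 cva; apply/cvgr0Pnorm_lt => s s0.
have s't : 0 < s `^ t^-1 by exact: powR_gt0.
move/cvgr0Pnorm_lt: cva => /(_ _ s't); apply: filterS => k.
rewrite !ger0_norm ?powR_ge0// => /(gt0_ltr_powR t0).
rewrite !nnegrE -powRrM mulVf ?gt_eqF// powRr1 ?(ltW s0)//.
by apply => //; rewrite powR_ge0.
Qed.

Lemma norm2_bigO (R : realType) (n : nat) (v : nat -> 'rV[R]_n)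
    (w : nat -> R) (A : R) :
  0 < A -> (\forall k \near \oo, `|v k| <= A * w k) ->
  (fun k => norm2 (v k)) =O_\oo w.
Proof.
(* [n.+1] instead of [n] keeps the constant positive in dimension 0. *)
move=> A0 vw; apply/eqO_exP; exists (n.+1%:R * A); first by rewrite mulr_gt0.
near=> k; rewrite ger0_norm; last exact: sqrtr_ge0.
apply: le_trans (norm2_le_norm _) _.
rewrite -mulrA; apply: (@le_trans _ _ (n.+1%:R * `|v k|)).
  by rewrite ler_wpM2r// ler_nat.
rewrite ler_wpM2l//; apply: (@le_trans _ _ (A * w k)).
  by near: k.
by rewrite ler_wpM2l ?ler_norm// ltW.
Unshelve. all: by end_near.
Qed.

(** * One step of the iteration under the Lojasiewicz inequality *)

(** Here a and b are consecutive gaps, g the gradient norm and d the step length. The tangent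
    inequality bounds a^t - b^t below by t a^(t-1) (a - b), and the Lojasiewicz inequality says that
    a^(t-1) c g >= 1. *)
Lemma lojasiewicz_step (R : realType) (t s c a b g d : R) :
  0 < t -> t < 1 -> 0 < s -> 0 < c -> 0 < a -> 0 <= b -> 0 <= d ->
  s * g * d <= a - b -> a `^ (1 - t) <= c * g ->
  d <= c / (t * s) * (a `^ t - b `^ t).
Proof.
move=> t0 t1 s0 c0 a0 b0 d0 dec KL.
have at0 : 0 < a `^ (t - 1) by exact: powR_gt0.
have inv : a `^ (t - 1) * a `^ (1 - t) = 1.
  rewrite -powRD ?(gt_eqF a0) ?implybT// (_ : t - 1 + (1 - t) = 0) ?powRr0//.
  by ring.
have ts0 : 0 < t * s by rewrite mulr_gt0.
have tan := powR_tangent_concave t0 t1 a0 b0.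
apply: le_trans (ler_wpM2l _ tan); last by rewrite divr_ge0// ltW.
have -> : c / (t * s) * (t * a `^ (t - 1) * (a - b)) =
    c * a `^ (t - 1) / s * (a - b).
  by field; rewrite !gt_eqF.
apply: le_trans (ler_wpM2l _ dec); last by rewrite !mulr_ge0 ?invr_ge0// ltW.
have -> : c * a `^ (t - 1) / s * (s * g * d) = a `^ (t - 1) * (c * g) * d.
  by field; rewrite gt_eqF.
by rewrite ler_peMl// -[leLHS]inv ler_pM2l.
Qed.

(** Since d >= kap g, the decrease is at least s kap g^2, and c g >= a^(1-t). The exponent 2 - 2t is
    written as 1 + al, the form used in [sublinear_rate]. *)
Lemma lojasiewicz_decrease (R : realType) (t s kap c a b g d : R) :
  0 < s -> 0 < c -> 0 <= a -> 0 <= g -> t <= 1 / 2 ->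
  s * g * d <= a - b -> kap * g <= d -> 0 < kap -> a `^ (1 - t) <= c * g ->
  s * kap / c ^+ 2 * a `^ (1 + (1 - 2 * t)) <= a - b.
Proof.
move=> s0 c0 a0 g0 t1 dec len kap0 KL.
have sq : a `^ (1 + (1 - 2 * t)) = (a `^ (1 - t)) ^+ 2.
  rewrite -powR_mulrn ?powR_ge0// -powRrM; congr (_ `^ _); ring.
apply: le_trans dec; apply: (@le_trans _ _ (s * g * (kap * g))); last first.
  by rewrite ler_wpM2l// mulr_ge0// ltW.
have sk0 : 0 < s * kap / c ^+ 2 by rewrite divr_gt0 ?mulr_gt0 ?exprn_gt0.
rewrite (_ : s * g * (kap * g) = s * kap / c ^+ 2 * (c * g) ^+ 2); last first.
  by field; rewrite gt_eqF.
by rewrite sq ler_pM2l// lerXn2r ?nnegrE ?powR_ge0// mulr_ge0// ltW.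
Qed.

(** * Gradient limit, convergence and rates *)

(* f is total, but its values outside U are irrelevant: U is open and only
   x k with 0 < k (the sequence is indexed from 1) enter the hypotheses. *)
Theorem theorem1p3 (R : realType) (n : nat)
    (U : set 'rV[R]_n) (f : 'rV[R]_n -> R) (x : nat -> 'rV[R]_n)
    (Uopen : open U)
    (fdiff : forall a, U a -> differentiable f a)
    (xU : forall k, (0 < k)%N -> U (x k))
    (Hi : exists2 sigma : R, 0 < sigma &
       \forall k \near \oo, f (x k) - f (x k.+1) >=
         sigma * norm2 (gradient f (x k)) * norm2 (x k.+1 - x k))
    (Hii : forall k, (0 < k)%N -> f (x k) = f (x k.+1) -> x k = x k.+1)
    (Hiii : exists2 kappa : R, 0 < kappa &
       \forall k \near \oo,
         norm2 (x k.+1 - x k) >= kappa * norm2 (gradient f (x k)))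
    (xstar : 'rV[R]_n) (xstar_cluster : cluster (x @ \oo) xstar)
    (V : set 'rV[R]_n) (Vopen : open V) (Vxstar : V xstar)
    (theta c : R) (theta_gt0 : 0 < theta) (theta_le : theta <= 1 / 2)
    (fx_cvg : cvg (f (x j) @[j --> \oo]))
    (KL : forall k, (0 < k)%N -> V (x k) ->
       `|f (x k) - lim (f (x j) @[j --> \oo])| `^ (1 - theta)
         <= c * norm2 (gradient f (x k))) :
  gradient f (x k) @[k --> \oo] --> (0 : 'rV[R]_n) /\
  (theta = 1 / 2 -> exists q : R, 0 < q < 1 /\
     (fun k => norm2 (xstar - x k)) =O_\oo (fun k => q ^+ k)) /\
  (theta < 1 / 2 ->
     (fun k => norm2 (xstar - x k)) =O_\oo
       (fun k => k%:R `^ (- theta / (1 - 2 * theta)))).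
Proof.
have [s s0 {}Hi] := Hi; have [kap kap0 {}Hiii] := Hiii.
set L := lim _ in KL.
have [K _ HK] := filterI (nbhs_infty_gt 0) (filterI Hi Hiii).
have K0 k : (K <= k)%N -> (0 < k)%N by move=> /HK[].
have dec k : (K <= k)%N -> s * norm2 (gradient f (x k)) * norm2 (x k.+1 - x k)
    <= f (x k) - f (x k.+1) by move=> /HK[_ []].
have len k : (K <= k)%N ->
    kap * norm2 (gradient f (x k)) <= norm2 (x k.+1 - x k).
  by move=> /HK[_ []].
have n2_ge0 (v : 'rV[R]_n) : 0 <= norm2 v by exact: sqrtr_ge0.
have fx_dec k : (K <= k)%N -> f (x k.+1) <= f (x k).
  move=> Kk; rewrite -subr_ge0; apply: le_trans (dec _ Kk).
  by rewrite !mulr_ge0// ltW.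
have fx_dec_add k i : (K <= k)%N -> f (x (k + i)%N) <= f (x k).
  move=> Kk; elim: i => [|i IH]; first by rewrite addn0.
  rewrite addnS; apply: le_trans (fx_dec _ _) IH.
  by rewrite (leq_trans Kk)// leq_addr.
have fx_ge k : (K <= k)%N -> L <= f (x k).
  move=> Kk; rewrite leNgt; apply/negP => fkL.
  have [N _ HN] := cvgr_gt L fx_cvg _ fkL.
  by have := HN (k + N)%N (leq_addl _ _); rewrite /= ltNge fx_dec_add.
(* The absolute value makes the gap nonnegative at every index; from [K] on it equals
   [f (x k) - L]. *)
pose a k := `|f (x k) - L|.
have a_ge0 k : 0 <= a k by exact: normr_ge0.
have aE k : (K <= k)%N -> a k = f (x k) - L.
  by move=> Kk; rewrite /a ger0_norm// subr_ge0 fx_ge.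
have aB k : (K <= k)%N -> a k - a k.+1 = f (x k) - f (x k.+1).
  by move=> Kk; rewrite !aE ?(leqW Kk)//; ring.
have a_cvg : a @ \oo --> (0 : R).
  apply/cvgr0Pnorm_lt => e e0; move/cvgrPdist_lt: (fx_cvg) => /(_ _ e0).
  by apply: filterS => k; rewrite /a normr_id distrC.
(* The given [c] may have any sign; [C] is a positive constant that still serves in the
   inequality. *)
have C0 : 0 < Num.max c 1 by rewrite lt_max ltr01 orbT.
move: C0; set C := Num.max c 1 => C0.
have {}KL k : (K <= k)%N -> V (x k) ->
    a k `^ (1 - theta) <= C * norm2 (gradient f (x k)).
  move=> Kk Vk; have := KL _ (K0 _ Kk) Vk; rewrite -/(a k).
  move=> /le_trans; apply; rewrite ler_wpM2r//.
  by rewrite le_max lexx.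
split.
  (* Conditions (i) and (iii) give s kap |grad f(x_k)|^2 <= a_k - a_(k+1) <= a_k, which tends to
     0. *)
  apply/cvgr0Pnorm_lt => e e0.
  have ske0 : 0 < s * kap * e ^+ 2 by rewrite !mulr_gt0 ?exprn_gt0.
  near=> k.
  have Kk : (K <= k)%N by near: k; exact: nbhs_infty_ge.
  have ak : a k < s * kap * e ^+ 2.
    apply: le_lt_trans (ler_norm _) _; near: k.
    by move/cvgr0Pnorm_lt: a_cvg; apply.
  apply: le_lt_trans (norm_le_norm2 _) _.
  rewrite -(@ltr_pXn2r _ 2)// ?nnegrE ?(ltW e0)//.
  rewrite -(@ltr_pM2l _ (s * kap)) ?mulr_gt0//; apply: le_lt_trans ak.
  apply: (@le_trans _ _ (a k - a k.+1)); last by rewrite gerBl.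
  rewrite aB//; apply: le_trans (dec _ Kk).
  rewrite (_ : s * kap * _ = s * norm2 (gradient f (x k)) *
    (kap * norm2 (gradient f (x k)))); last by ring.
  by rewrite ler_wpM2l ?len// mulr_ge0// ltW.
have theta1 : theta < 1 by lra.
have D0 : 0 < C / (theta * s) by rewrite divr_gt0 ?mulr_gt0.
move: D0; set D := C / _ => D0.
have [r r0 ballV] : exists2 r : R, 0 < r & forall y, `|xstar - y| < r -> V y.
  have : nbhs xstar V by exact: open_nbhs_nbhs.
  by move=> /nbhs_ballP[r r0 rV]; exists r => // y yr;
    apply: rV; rewrite -ball_normE.
have step k : (K <= k)%N -> `|xstar - x k| < r ->
    `|x k.+1 - x k| <= D * a k `^ theta - D * a k.+1 `^ theta.
  move=> Kk /ballV xkV.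
  have aS : a k.+1 <= a k by rewrite -subr_ge0 aB// subr_ge0 fx_dec.
  have := a_ge0 k; rewrite le_eqVlt => /predU1P[ak0|ak].
    have aS0 : a k.+1 = 0 by apply/eqP; rewrite eq_le a_ge0 ak0 aS.
    have fE : f (x k) = f (x k.+1).
      by apply/eqP; rewrite -subr_eq0 -aB// aS0 -ak0 subrr.
    by rewrite -(Hii _ (K0 _ Kk) fE) subrr normr0 aS0 -ak0 subrr.
  rewrite -mulrBr; apply: le_trans (norm_le_norm2 _) _.
  by apply: lojasiewicz_step (KL _ Kk xkV) => //; rewrite aB// dec.
have e_cvg : D * a k `^ theta @[k --> \oo] --> (0 : R).
  by rewrite -(mulr0 D); apply: cvgMr; exact: cvg_powR0.
have e_ge0 k : 0 <= D * a k `^ theta by rewrite mulr_ge0 ?powR_ge0// ltW.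
have dist := cluster_trapping r0 xstar_cluster e_cvg e_ge0 step.
(* From [K'] on the iterates stay in the ball, so the Lojasiewicz inequality holds at every
   index. *)
have [K' _ HK'] : \forall k \near \oo, (K <= k)%N /\ `|xstar - x k| < r.
  near=> k; split; first by near: k; exact: nbhs_infty_ge.
  apply: (@le_lt_trans _ _ (D * a k `^ theta)); first by near: k.
  apply: le_lt_trans (ler_norm _) _; near: k.
  by move/cvgr0Pnorm_lt: e_cvg; apply.
have M0 : 0 < s * kap / C ^+ 2 by rewrite divr_gt0 ?mulr_gt0 ?exprn_gt0.
move: M0; set M := s * kap / _ => M0.
have decay k : (K' <= k)%N -> M * a k `^ (1 + (1 - 2 * theta)) <= a k - a k.+1.
  move=> /HK'[Kk /ballV xkV].
  apply: (lojasiewicz_decrease s0 C0 (a_ge0 k) (n2_ge0 _) theta_le _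
    (len _ Kk) kap0 (KL _ Kk xkV)).
  by rewrite aB// dec.
split=> theta_half.
  (* The gap contracts by 1 - M, which may fail to be positive; the maximum with 1/2 gives a ratio
     in (0, 1). *)
  pose q : R := Num.max (1 - M) (1 / 2).
  have q0 : 0 < q by rewrite lt_max divr_gt0 ?orbT.
  have q1 : q < 1 by rewrite gt_max; apply/andP; split; lra.
  have [A A0 aA] : exists2 A : R, 0 < A &
      forall k, (K' <= k)%N -> a k <= A * q ^+ k.
    apply: geometric_decay => // k /decay.
    rewrite theta_half (_ : 1 + _ = 1) ?powRr1//; last by field.
    have : (1 - M) * a k <= q * a k by rewrite ler_wpM2r// le_max lexx.
    lra.
  (* The distance is controlled by a_k^theta, so the ratio q of the gaps becomes q^theta. *)
  exists (q `^ theta); split.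
    rewrite powR_gt0//=; have := gt0_ltr_powR theta_gt0 (x := q) (y := 1).
    by rewrite powR1; apply; rewrite ?nnegrE// ltW.
  apply: (@norm2_bigO _ _ _ _ (D * A `^ theta)).
    by rewrite mulr_gt0 ?powR_gt0.
  near=> k; apply: (@le_trans _ _ (D * a k `^ theta)); first by near: k.
  rewrite -[leRHS]mulrA ler_pM2l// -powR_mulrn ?powR_ge0// powRAC.
  rewrite powR_mulrn ?(ltW q0)//.
  rewrite -powRM ?exprn_ge0 ?(ltW A0) ?(ltW q0)//.
  apply: ge0_ler_powR; rewrite ?nnegrE ?(ltW theta_gt0)//.
    by rewrite mulr_ge0 ?exprn_ge0 ?(ltW A0) ?(ltW q0).
  by apply: aA; near: k; exact: nbhs_infty_ge.
have al0 : 0 < 1 - 2 * theta by lra.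
have [B B0 aB'] := sublinear_rate al0 M0 theta_gt0 (fun k _ => a_ge0 k) decay.
apply: (@norm2_bigO _ _ _ _ (D * B)); first by rewrite mulr_gt0.
near=> k; apply: (@le_trans _ _ (D * a k `^ theta)); first by near: k.
by rewrite -[leRHS]mulrA ler_pM2l//; near: k.
Unshelve. all: by end_near.
Qed.
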